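(* Let $m$ be even and let $c$ be an integer with $1\le c<m/2$ such that $m/\gcd(m,c)$ is even. Then $G_{\alpha}(m;1,1,c)$ is 3-edge-colorable.
   Context: Let $G$ be the graph with the 11 vertices $A,B,A',B',v,x_1,\dots,x_6$ and the 14 edges $Av,\ vA',\ Ax_6,\ x_6x_2,\ x_6x_5,\ x_2x_4,\ x_2B,\ x_4x_3,\ x_4B',\ x_3A',\ x_3x_5,\ x_5x_1,\ x_1B,\ x_1B'$. For integers $m\ge 3$, $a,b$ with $1\le a,b\le m-1$ and $1\le c<m/2$, $G_{\alpha}(m;a,b,c)$ is the cubic graph with vertex set $\{u_i: u\in V(G),\ i\in\mathbb{Z}_m\}\cup\{w_i: i\in\mathbb{Z}_m\}$ and edges $u_iu'_i$ for every edge $uu'$ of $G$, spoke edges $v_iw_i$, loop edges $w_iw_{i+c}$, and connecting edges $A'_iA_{i+a}$, $B'_iB_{i+b}$ (indices mod $m$). *)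

(* Defs.v *)
From HB Require Import structures.
From mathcomp Require Import all_boot.

Set Implicit Arguments.
Unset Strict Implicit.
Unset Printing Implicit Defensive.

(* A simple graph on a finType is given by its adjacency relation, assumed
   symmetric and irreflexive; an edge is a two-element set of vertices. *)
Definition edges (T : finType) (adj : rel T) : {set {set T}} :=
  [set e | [exists x, exists y, adj x y && (e == [set x; y])]].

Definition proper_edge_coloring (T : finType) (adj : rel T) (k : nat)
    (col : {set T} -> 'I_k) : Prop :=
  forall e f : {set T}, e \in edges adj -> f \in edges adj ->
    e != f -> e :&: f != set0 -> col e != col f.

Definition edge_colorable (T : finType) (adj : rel T) (k : nat) : Prop :=
  exists col : {set T} -> 'I_k, proper_edge_coloring adj col.

(* Primes are written as a trailing p: GAp is A', GBp is B'. *)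
Inductive Gvertex : Type :=
  GA | GB | GAp | GBp | Gv | Gx1 | Gx2 | Gx3 | Gx4 | Gx5 | Gx6.

Definition Gvertex_code (u : Gvertex) : 'I_11 :=
  match u with
  | GA => @Ordinal 11 0 isT
  | GB => @Ordinal 11 1 isT
  | GAp => @Ordinal 11 2 isT
  | GBp => @Ordinal 11 3 isT
  | Gv => @Ordinal 11 4 isT
  | Gx1 => @Ordinal 11 5 isT
  | Gx2 => @Ordinal 11 6 isT
  | Gx3 => @Ordinal 11 7 isT
  | Gx4 => @Ordinal 11 8 isT
  | Gx5 => @Ordinal 11 9 isT
  | Gx6 => @Ordinal 11 10 isT
  end.

Definition Gvertex_decode (i : 'I_11) : Gvertex :=
  nth GA [:: GA; GB; GAp; GBp; Gv; Gx1; Gx2; Gx3; Gx4; Gx5; Gx6] i.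

Lemma Gvertex_codeK : cancel Gvertex_code Gvertex_decode.
Proof. by case. Qed.

HB.instance Definition _ := Finite.copy Gvertex (can_type Gvertex_codeK).

Definition Gedges : seq (Gvertex * Gvertex) :=
  [:: (GA, Gv); (Gv, GAp); (GA, Gx6); (Gx6, Gx2); (Gx6, Gx5);
      (Gx2, Gx4); (Gx2, GB); (Gx4, Gx3); (Gx4, GBp); (Gx3, GAp);
      (Gx3, Gx5); (Gx5, Gx1); (Gx1, GB); (Gx1, GBp)].

(* inl (u, i) is u_i for u a vertex of G, and inr i is w_i; the index set Z_m
   is 'I_m with congruences modulo m. *)
Definition Galpha_vertex (m : nat) : Type := (Gvertex * 'I_m + 'I_m)%type.

Definition Galpha_arc (m a b c : nat) (x y : Galpha_vertex m) : bool :=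
  match x, y with
  | inl (u, i), inl (u', j) =>
      [|| ((u, u') \in Gedges) && (i == j),
          [&& u == GAp, u' == GA & j == i + a %[mod m]]
        | [&& u == GBp, u' == GB & j == i + b %[mod m]]]
  | inl (u, i), inr j => (u == Gv) && (i == j)
  | inr i, inr j => j == i + c %[mod m]
  | inr _, inl _ => false
  end.

Definition Galpha (m a b c : nat) : rel (Galpha_vertex m) :=
  fun x y => Galpha_arc a b c x y || Galpha_arc a b c y x.

Lemma Galpha_sym (m a b c : nat) : symmetric (@Galpha m a b c).
Proof. by move=> x y; rewrite /Galpha orbC. Qed.

Lemma Galpha_irrefl (m a b c : nat) :
  0 < c -> c < m -> irreflexive (@Galpha m a b c).
Proof.
move=> c_gt0 c_lt [[u i]|i]; rewrite /Galpha orbb /=.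
  apply/negbTE; rewrite eqxx andbT; apply/or3P; case; first by case: u.
    by case/and3P=> /eqP->.
  by case/and3P=> /eqP->.
by rewrite -[X in X == _ %[mod _]]addn0 eqn_modDl mod0n modn_small //= ltn_eqF.
Qed.

(* Main.v *)
(** Since [m / gcd(m, c)] is even, every cycle formed by the loop edges has even
    length, so the loop edges can be colored alternately with two colors and all
    spokes with the third one.  It then suffices to color each copy of [G], with
    its connecting edges, so that the spoke color is missing at [v]; this is done
    by one explicit coloring of [G], used with the two loop colors exchanged in
    the copies of odd index.  As [m] is even, this fits together cyclically. *)
Require Import Defs.
From mathcomp Require Import all_boot.

(** Reduces edge colorings on two-element sets to a function of ordered pairs: symmetry of [h] on
    adjacent pairs makes the color of an edge well defined, and injectivity at each vertex makes it
    proper. *)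
Lemma edge_colorable_locally (T C : finType) (adj : rel T) (k : nat)
    (h : T -> T -> C) :
  #|C| <= k.+1 -> symmetric adj ->
  (forall x y, adj x y -> h x y = h y x) ->
  (forall x y z, adj x y -> adj x z -> h x y = h x z -> y = z) ->
  edge_colorable adj k.+1.
Proof.
move=> leCk adjC hC h_inj.
(* [None] arises only for sets that are not edges, where any color will do. *)
pose code (o : option C) : 'I_k.+1 :=
  if o is Some a then widen_ord leCk (enum_rank a) else ord0.
pose col (e : {set T}) :=
  code (omap (fun p : T * T => h p.1 p.2)
    [pick p : T * T | adj p.1 p.2 && (e == [set p.1; p.2])]).
have colE x y : adj x y -> col [set x; y] = widen_ord leCk (enum_rank (h x y)).
  (* The picked pair is [(x, y)] up to order, and [hC] makes the order irrelevant. *)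
  move=> xy; rewrite /col; case: pickP => [[x' y'] /= /andP[xy' /eqP E] |].
    have x'in : x' \in [set x; y] by rewrite E set21.
    have y'in : y' \in [set x; y] by rewrite E set22.
    have xin : x \in [set x'; y'] by rewrite -E set21.
    have yin : y \in [set x'; y'] by rewrite -E set22.
    congr (widen_ord _ (enum_rank _)).
    case/set2P: x'in xin yin xy' => ->; case/set2P: y'in => -> //.
    - by move=> _ /set2P[] ->.
    - by move=> _ _ /hC.
    - by move=> /set2P[] ->.
  by move/(_ (x, y)); rewrite /= xy eqxx.
exists col => e f; rewrite !inE.
case/existsP=> x /existsP[y /andP[xy /eqP->]].
case/existsP=> x' /existsP[y' /andP[xy' /eqP->]] neq /set0Pn[t].
rewrite inE => /andP[te tf].
have end_at (a b : T) : adj a b -> t \in [set a; b] ->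
    exists2 s, adj t s & [set a; b] = [set t; s].
  move=> ab /set2P[]->; first by exists b.
  by exists a; rewrite ?(setUC [set a]) // adjC.
have [s ts E] := end_at _ _ xy te; have [s' ts' E'] := end_at _ _ xy' tf.
rewrite E E' !colE //.
apply: contraNneq neq => /(congr1 val) /= /ord_inj/enum_rank_inj H.
by rewrite E E' (h_inj _ _ _ ts ts' H).
Qed.

(* [None] is the color of the spokes.  The color of a connecting edge is read
   relative to the parity of the index of the first vertex, hence the values at
   [(GB, GBp)] and [(GBp, GB)] differ. *)
Definition Gcol (u u' : Gvertex) : option bool :=
  match u, u' with
  | GA, Gv | Gv, GA => Some false
  | Gv, GAp | GAp, Gv => Some true
  | GA, Gx6 | Gx6, GA => Some true
  | Gx6, Gx2 | Gx2, Gx6 => Some false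
  | Gx6, Gx5 | Gx5, Gx6 => None
  | Gx2, Gx4 | Gx4, Gx2 => Some true
  | Gx2, GB | GB, Gx2 => None
  | Gx4, Gx3 | Gx3, Gx4 => None
  | Gx4, GBp | GBp, Gx4 => Some false
  | Gx3, GAp | GAp, Gx3 => Some false
  | Gx3, Gx5 | Gx5, Gx3 => Some true
  | Gx5, Gx1 | Gx1, Gx5 => Some false
  | Gx1, GB | GB, Gx1 => Some true
  | Gx1, GBp | GBp, Gx1 => None
  | GBp, GB => Some true
  | GB, GBp => Some false
  | _, _ => None
  end.

(** Adjacency away from the [w] vertices with indices forgotten, so that properness there becomes a
    finite check. *)
Definition Glink (u u' : Gvertex) : bool :=
  [|| (u, u') \in Gedges, (u', u) \in Gedges |
      (u, u') \in [:: (GAp, GA); (GA, GAp); (GBp, GB); (GB, GBp)]].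

(** The catch-all case of [Gcol] gives [None] to the connecting edges between [GAp] and [GA], the
    color that the edges of [G] leave free at both ends. *)
Lemma Gcol_inj u u1 u2 :
  Glink u u1 -> Glink u u2 -> Gcol u u1 = Gcol u u2 -> u1 = u2.
Proof. by case: u; case: u1 => //; case: u2. Qed.

Lemma Gcol_v u : Glink Gv u -> Gcol Gv u <> None.
Proof. by case: u. Qed.

Lemma Gcol_sym u u' : (u, u') \in Gedges -> Gcol u u' = Gcol u' u.
Proof. by case: u; case: u'. Qed.

Lemma eqmod_ord (m : nat) (i j : 'I_m) : (i == j %[mod m]) = (i == j).
Proof. by rewrite !modn_small. Qed.

(** If both quotients were even, twice the gcd would divide [m] and [c], hence the gcd itself. *)
Lemma odd_div_gcdn (m c : nat) :
  0 < m -> ~~ odd (m %/ gcdn m c) -> odd (c %/ gcdn m c).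
Proof.
move=> m_gt0; have d_gt0 : 0 < gcdn m c by rewrite gcdn_gt0 m_gt0.
rewrite -!dvdn2 => m2; apply/negPn; rewrite -dvdn2; apply/negP => c2.
have: 2 * gcdn m c %| gcdn m c.
  by rewrite dvdn_gcd -!dvdn_divRL ?m2 ?c2 ?dvdn_gcdl ?dvdn_gcdr.
by move/(dvdn_leq d_gt0); rewrite leqNgt ltn_Pmull.
Qed.

(** Adding [c] adds the odd number [c %/ gcdn m c] to the quotient of [i]; reducing modulo [m]
    subtracts a multiple of the even number [m %/ gcdn m c]. So this parity alternates along every
    loop cycle. *)
Lemma odd_div_shift (m c i j : nat) :
  0 < m -> ~~ odd (m %/ gcdn m c) -> j < m -> j = i + c %[mod m] ->
  odd (j %/ gcdn m c) = ~~ odd (i %/ gcdn m c).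
Proof.
move=> m_gt0 mc lt_jm; rewrite modn_small // => jE.
have d_gt0 : 0 < gcdn m c by rewrite gcdn_gt0 m_gt0.
have: odd ((i + c) %/ gcdn m c) = ~~ odd (i %/ gcdn m c).
  by rewrite divnDr ?dvdn_gcdr // oddD odd_div_gcdn ?addbT.
rewrite {1}(divn_eq (i + c) m) -jE divnDl ?dvdn_mull ?dvdn_gcdl //.
by rewrite oddD -muln_divA ?dvdn_gcdl // oddM (negbTE mc) andbF.
Qed.

(** [addb (odd i)] exchanges the two loop colors at odd indices and [omap] fixes [None]. A loop edge
    takes its color from its tail; the test finds the tail whatever the order of the arguments. *)
Definition Galpha_col (m c : nat) (x y : Galpha_vertex m) : option bool :=
  match x, y with
  | inl (u, i), inl (u', _) => omap (addb (odd i)) (Gcol u u')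
  | inr i, inr j =>
      Some (odd ((if j == i + c %[mod m] then i else j) %/ gcdn m c))
  | _, _ => None
  end.

Section Galpha_coloring.

Variables m c : nat.
Hypotheses (m_even : ~~ odd m) (c_gt0 : 1 <= c) (c_lt : 2 * c < m).
Hypothesis mc_even : ~~ odd (m %/ gcdn m c).

Let m_gt0 : 0 < m. Proof. exact: leq_ltn_trans c_lt. Qed.

(** Arcs in both directions would force [2 * c] to vanish modulo [m]; hence the tail of a loop edge
    is unambiguous. *)
Lemma loop_asym (i j : nat) : j = i + c %[mod m] -> (i == j + c %[mod m]) = false.
Proof.
move=> jE; rewrite -modnDml jE modnDml -addnA addnn -mul2n.
rewrite -[X in X == _ %[mod _]]addn0 eqn_modDl mod0n modn_small //.
by rewrite eq_sym muln_eq0 (gtn_eqF c_gt0).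
Qed.

Lemma odd_succ_mod (i j : nat) : j = i + 1 %[mod m] -> odd j = ~~ odd i.
Proof.
have oddm n : odd (n %% m) = odd n.
  by rewrite {2}(divn_eq n m) oddD oddM (negbTE m_even) andbF.
by move/(congr1 odd); rewrite !oddm addn1.
Qed.

Lemma Galpha_col_sym (x y : Galpha_vertex m) :
  Galpha 1 1 c x y -> Galpha_col m c x y = Galpha_col m c y x.
Proof.
wlog: x y / Galpha_arc 1 1 c x y.
  by move=> IH /orP[] H; [|symmetry]; apply: IH => //; rewrite /Galpha H ?orbT.
move=> + _; case: x y => [[u i]|i] [[u' j]|j] //=.
  (* From [GAp] to [GA] the color [None] ignores parity; from [GBp] to [GB] the change of parity
     cancels the asymmetry of [Gcol]. *)
  case/or3P=> [/andP[uu' /eqP->]| /and3P[/eqP-> /eqP->]// |].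
    by rewrite (Gcol_sym _ _ uu').
  by case/and3P=> /eqP-> /eqP-> /eqP/odd_succ_mod /= ->; case: odd.
by move=> ij; rewrite ij loop_asym //; apply/eqP.
Qed.

Lemma Galpha_Glink (u u' : Gvertex) (i j : 'I_m) :
  Galpha 1 1 c (inl (u, i)) (inl (u', j)) -> Glink u u'.
Proof.
rewrite /Galpha /Glink /= => /orP[]/or3P[/andP[-> _]| |]; rewrite ?orbT //;
by case/and3P=> /eqP-> /eqP->.
Qed.

(** A pair [u], [u'] admits only one kind of edge (equal indices, shift forward or shift backward),
    and each kind determines the second index. *)
Lemma Galpha_index_inj (u u' : Gvertex) (i j1 j2 : 'I_m) :
  Galpha 1 1 c (inl (u, i)) (inl (u', j1)) ->
  Galpha 1 1 c (inl (u, i)) (inl (u', j2)) -> j1 = j2.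
Proof.
rewrite /Galpha /=.
have fwd : j1 == i + 1 %[mod m] -> j2 == i + 1 %[mod m] -> j1 = j2.
  by move=> /eqP E /eqP E'; apply/eqP; rewrite -eqmod_ord E E'.
have bwd : i == j1 + 1 %[mod m] -> i == j2 + 1 %[mod m] -> j1 = j2.
  by move=> /eqP->; rewrite eqn_modDr eqmod_ord => /eqP.
have same : i == j1 -> i == j2 -> j1 = j2 by move=> /eqP<- /eqP.
(* The index equations are abstracted to booleans, which leaves a propositional check for each pair
   of vertices of [G]. *)
rewrite ![_ == i]eq_sym; move: (i == j1) (i == j2) same.
move: (j1 == _ %[mod m]) (j2 == _ %[mod m]) fwd.
move: (i == j1 + 1 %[mod m]) (i == j2 + 1 %[mod m]) bwd.
move=> b1 b2 bwd f1 f2 fwd e1 e2 same.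
case: u; case: u' => //=; rewrite ?inE /= ?orbF; auto.
Qed.

Lemma Galpha_col_inj (x y z : Galpha_vertex m) :
  Galpha 1 1 c x y -> Galpha 1 1 c x z ->
  Galpha_col m c x y = Galpha_col m c x z -> y = z.
Proof.
have omap_inj b : injective (omap (addb b)) by case: b => [] [[]|] [[]|].
case: x => [[u i]|i].
  case: y z => [[u1 j1]|j1] [[u2 j2]|j2] xy xz /=.
  - have [l1 l2] := (Galpha_Glink _ _ _ _ xy, Galpha_Glink _ _ _ _ xz).
    move/omap_inj/(Gcol_inj _ _ _ l1 l2) => E.
    by rewrite -E in xz *; rewrite (Galpha_index_inj _ _ _ _ _ xy xz).
  - move: xz (Galpha_Glink _ _ _ _ xy); rewrite /Galpha /= orbF.
    case/andP=> /eqP-> _ /Gcol_v.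
    by case: Gcol.
  - move: xy (Galpha_Glink _ _ _ _ xz); rewrite /Galpha /= orbF.
    case/andP=> /eqP-> _ /Gcol_v.
    by case: Gcol.
  - move: xy xz; rewrite /Galpha /= !orbF.
    by case/andP=> _ /eqP<- /andP[_ /eqP<-].
case: y z => [[u1 j1]|j1] [[u2 j2]|j2] //; rewrite /Galpha /=.
  by case/andP=> /eqP-> /eqP-> /andP[/eqP-> /eqP->].
(* The loop edge entering [i] is colored by its tail [j], the one leaving [i] by [i] itself, and
   these parities differ. *)
have mixed (j : 'I_m) : i == j + c %[mod m] ->
    odd (i %/ gcdn m c) <> odd (j %/ gcdn m c).
  by move=> /eqP/odd_div_shift-> //; case: odd.
(* Two edges that both leave or both enter [i] coincide, by cancellation modulo [m]; the mixed cases
   contradict the equality of colors. *)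
case: (boolP (j1 == _ %[mod m])) => H1 /= => [_|B1];
case: (boolP (j2 == _ %[mod m])) => H2 /= => [_|B2] /Some_inj.
- by move=> _; congr inr; apply/eqP; rewrite -eqmod_ord (eqP H1) (eqP H2).
- by move/(mixed _ B2).
- by move/esym/(mixed _ B1).
- move=> _; congr inr; apply/eqP.
  by rewrite -eqmod_ord -(eqn_modDr c) -(eqP B1) -(eqP B2).
Qed.

End Galpha_coloring.

Theorem theorem6 (m c : nat) (m_even : ~~ odd m)
    (c_gt0 : 1 <= c) (c_lt : 2 * c < m)
    (mc_even : ~~ odd (m %/ gcdn m c)) :
  edge_colorable (@Galpha m 1 1 c) 3.
Proof.
apply: (@edge_colorable_locally _ _ _ _ (@Galpha_col m c)).
- by rewrite card_option card_bool.
- exact: Galpha_sym.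
- exact: Galpha_col_sym.
- exact: Galpha_col_inj.
Qed.
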